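(* Let $A_n(x,y,q,p,s)=\sum_{\sigma\in\mathfrak{S}_n}x^{\operatorname{wex}\sigma}y^{\operatorname{fix}\sigma}q^{\operatorname{cros}\sigma}p^{\operatorname{nest}\sigma}s^{\operatorname{inv}\sigma}$. Then, as formal power series in $t$, $$1+\sum_{n\ge1}A_n(x,y,q,p,s)\, t^n =\cfrac{1}{1-b_0t-\cfrac{a_0c_1t^2}{1-b_1t-\cfrac{a_1c_2t^2}{1-b_2t-\cfrac{a_2c_3t^2}{\ddots}}}},$$ where $a_h=x s^{2h+1} [h+1]_{q,ps}$, $b_h = xyp^h s^{2h} + (1+xq) s^h [h]_{q,ps}$, and $c_h= [h]_{q,ps}$.
   Context: $\mathfrak{S}_n$ is the set of permutations of $[n]$. For $\sigma\in\mathfrak{S}_n$: $\operatorname{wex}\sigma=\#\{i:\sigma_i\ge i\}$, $\operatorname{fix}\sigma=\#\{i:\sigma_i=i\}$, $\operatorname{cros}\sigma=\#\{(i,j): i<j\le\sigma_i<\sigma_j \text{ or } \sigma_i<\sigma_j<i<j\}$, $\operatorname{nest}\sigma=\#\{(i,j): i<j\le\sigma_j<\sigma_i \text{ or } \sigma_j<\sigma_i<i<j\}$, $\operatorname{inv}\sigma=\#\{(i,j):i<j,\ \sigma_i>\sigma_j\}$. For variables $a,b$ and $m\ge0$, $[m]_{a,b}=(a^m-b^m)/(a-b)=\sum_{i=0}^{m-1}a^ib^{m-1-i}$. *)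

(* Defs.v *)
From mathcomp Require Import all_boot all_order all_algebra all_fingroup.
Set Implicit Arguments. Unset Strict Implicit. Unset Printing Implicit Defensive.
Import GRing.Theory.
Local Open Scope ring_scope.

(* Permutations of [n] are represented by 'S_n, acting on {0,...,n-1};
   all statistics below only involve comparisons, so the shift by one is harmless. *)
Section Stats.
Variable n : nat.
Implicit Types s : 'S_n.

Definition wex s : nat := #|[set i : 'I_n | (i <= s i)%N]|.
Definition fixn s : nat := #|[set i : 'I_n | s i == i]|.
Definition cros s : nat :=
  #|[set ij : 'I_n * 'I_n |
     let i := ij.1 in let j := ij.2 in
     [&& (i < j)%N, (j <= s i)%N & (s i < s j)%N]
     || [&& (s i < s j)%N, (s j < i)%N & (i < j)%N]]|.
Definition nest s : nat :=
  #|[set ij : 'I_n * 'I_n |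
     let i := ij.1 in let j := ij.2 in
     [&& (i < j)%N, (j <= s j)%N & (s j < s i)%N]
     || [&& (s j < s i)%N, (s i < i)%N & (i < j)%N]]|.
Definition invn s : nat :=
  #|[set ij : 'I_n * 'I_n | (ij.1 < ij.2)%N && (s ij.2 < s ij.1)%N]|.
End Stats.

Section Series.
Variable R : comNzRingType.

Definition An (n : nat) (x y q p s : R) : R :=
  \sum_(sg : 'S_n) x ^+ wex sg * y ^+ fixn sg * q ^+ cros sg
                   * p ^+ nest sg * s ^+ invn sg.

Definition qint (a b : R) (m : nat) : R := \sum_(i < m) a ^+ i * b ^+ (m.-1 - i)%N.

Definition fps := nat -> R.

(* Coefficients g_0..g_m of the inverse of a series f with f_0 = 1:
   g_0 = 1, g_m = - sum_{i=1}^m f_i g_{m-i}. *)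
Fixpoint fps_inv_seq (f : fps) (m : nat) : seq R :=
  match m with
  | 0 => [:: 1]
  | m'.+1 => let g := fps_inv_seq f m' in
             rcons g (- \sum_(i < m'.+1) f i.+1 * nth 0 g (m' - i)%N)
  end.

Definition fps_inv (f : fps) : fps := fun m => nth 0 (fps_inv_seq f m) m.

Definition fps_one : fps := fun m => (m == 0)%:R.

Section JFrac.
Variables (x y q p s : R).
Definition ja (h : nat) : R := x * s ^+ (2 * h + 1) * qint q (p * s) h.+1.
Definition jb (h : nat) : R :=
  x * y * p ^+ h * s ^+ (2 * h) + (1 + x * q) * s ^+ h * qint q (p * s) h.
Definition jc (h : nat) : R := qint q (p * s) h.

(* jconv k h = k-th convergent of the tail of the J-fraction starting at level h:
   jconv 0 h = 1,
   jconv k.+1 h = 1 / (1 - b_h t - a_h c_{h+1} t^2 * jconv k (h+1)). *)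
Fixpoint jconv (k h : nat) : fps :=
  match k with
  | 0 => fps_one
  | k'.+1 =>
      let F := jconv k' h.+1 in
      fps_inv (fun m => (m == 0)%:R - (if m == 1 then jb h else 0)
                         - ja h * jc h.+1 * (if (2 <= m)%N then F (m - 2)%N else 0))
  end.
End JFrac.
End Series.

(* Main.v *)
(** Read a permutation of [n] as a diagram and reveal positions and values
    one index at a time: after [k] steps there are [h] positions [<= k] whose
    image is still unknown ("open") and [h] values [<= k] whose preimage is
    still unknown.  Relabelling what remains gives a permutation whose first
    [h] positions all have images [>= h] ([opening h h]).  With the ordinary
    weight on such permutations, their generating function satisfies a
    recursion: index [h] either opens both its position and its value, or is a
    fixed point, or its value and/or its position is matched with one of the
    [h] open positions or values; each match removes a point ([lift_perm])
    and the [j]-th choice contributes [q^(h-1-j) (p s)^j] up to a power of [s],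
    whence the factors [[h]_{q,ps}].  Pulling out [x^h s^(h^2)], the
    contribution of the open arcs alone, this is the recursion for weighted
    Motzkin paths of final height 0.  On the other side, decomposing a path
    from height [h] by its first visits to [h-1], ..., 1, 0 expresses its
    generating series as a product of tails of the J-fraction. *)
Require Import Defs.
From mathcomp Require Import all_boot all_order all_algebra all_fingroup.
From mathcomp Require Import zify ring.
Set Implicit Arguments. Unset Strict Implicit. Unset Printing Implicit Defensive.
Import GRing.Theory.
Local Open Scope ring_scope.

(** * Statistics under removal of a point *)

Section PointRemoval.
Local Open Scope nat_scope.

(** The condition [c] takes natural numbers, so that removing a point only substitutes [bump] into
    its arguments. *)
Definition stat1 n (c : nat -> nat -> bool) (t : 'S_n) :=
  \sum_(i < n) c i (t i).

Definition stat2 n (c : nat -> nat -> nat -> nat -> bool) (t : 'S_n) :=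
  \sum_(i < n) \sum_(j < n) c i j (t i) (t j).

Definition cross (i j a b : nat) :=
  [&& i < j, j <= a & a < b] || [&& a < b, b < i & i < j].
Definition nesting (i j a b : nat) :=
  [&& i < j, j <= b & b < a] || [&& b < a, a < i & i < j].
Definition inversion (i j a b : nat) := (i < j) && (b < a).

Lemma card_stat1 n (c : nat -> nat -> bool) (t : 'S_n) :
  #|[set i : 'I_n | c i (t i)]| = stat1 c t.
Proof. by rewrite -sum1dep_card big_mkcond; apply: eq_bigr => i _; case: c. Qed.

Lemma card_stat2 n (c : nat -> nat -> nat -> nat -> bool) (t : 'S_n) :
  #|[set ij : 'I_n * 'I_n | c ij.1 ij.2 (t ij.1) (t ij.2)]| = stat2 c t.
Proof.
rewrite -sum1dep_card big_mkcond /stat2 pair_bigA.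
by apply: eq_bigr => i _; case: c.
Qed.

Lemma wexE n (t : 'S_n) : wex t = stat1 leq t.
Proof. exact: card_stat1. Qed.
Lemma fixnE n (t : 'S_n) : fixn t = stat1 (fun i a => a == i) t.
Proof. exact: card_stat1. Qed.
Lemma crosE n (t : 'S_n) : cros t = stat2 cross t.
Proof. exact: card_stat2. Qed.
Lemma nestE n (t : 'S_n) : nest t = stat2 nesting t.
Proof. exact: card_stat2. Qed.
Lemma invnE n (t : 'S_n) : invn t = stat2 inversion t.
Proof. exact: card_stat2. Qed.

Lemma stat1_lift n (c : nat -> nat -> bool) (u v : 'I_n.+1) (t : 'S_n) :
  stat1 c (lift_perm u v t) =
    c u v + stat1 (fun i a => c (bump u i) (bump v a)) t.
Proof.
rewrite /stat1 (bigD1_ord u) //= lift_perm_id; congr addn.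
by apply: eq_bigr => i _; rewrite lift_perm_lift.
Qed.

(** Pairs are split by whether they contain the point [(u, v)]; the hypothesis discards that point
    paired with itself. *)
Lemma stat2_lift n (c : nat -> nat -> nat -> nat -> bool)
    (u v : 'I_n.+1) (t : 'S_n) :
  ~~ c u u v v ->
  stat2 c (lift_perm u v t) =
    \sum_(j < n) ((c u (bump u j) v (bump v (t j)) : nat) +
                  c (bump u j) u (bump v (t j)) v)
    + stat2 (fun i j a b => c (bump u i) (bump u j) (bump v a) (bump v b)) t.
Proof.
move=> /negbTE cuv; rewrite /stat2 (bigD1_ord u) //= (bigD1_ord u) //=.
rewrite lift_perm_id cuv add0n big_split -addnA; congr addn.
  by apply: eq_bigr => j _; rewrite lift_perm_lift.
rewrite -big_split; apply: eq_bigr => i _ /=.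
rewrite (bigD1_ord u) //= lift_perm_id lift_perm_lift; congr addn.
by apply: eq_bigr => j _; rewrite lift_perm_lift.
Qed.

Lemma eq_stat1 n (c c' : nat -> nat -> bool) (t : 'S_n) :
  (forall i : 'I_n, c i (t i) = c' i (t i)) -> stat1 c t = stat1 c' t.
Proof. by move=> ecc'; apply: eq_bigr => i _; rewrite ecc'. Qed.

Lemma eq_stat2 n (c c' : nat -> nat -> nat -> nat -> bool) (t : 'S_n) :
  (forall i j : 'I_n, c i j (t i) (t j) = c' i j (t i) (t j)) ->
  stat2 c t = stat2 c' t.
Proof.
by move=> ecc'; apply: eq_bigr => i _; apply: eq_bigr => j _; rewrite ecc'.
Qed.

Lemma sum_ord_between n a b : a <= b -> b <= n ->
  \sum_(j < n) (a <= j < b) = b - a.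
Proof.
move=> ab bn; rewrite -[RHS]muln1 -sum_nat_const_nat.
rewrite (big_nat_widen _ _ n) // (big_nat_widenl _ 0) // big_mkord.
by rewrite [RHS]big_mkcond; apply: eq_bigr => j _ /=; rewrite andbC; case: ifP.
Qed.

Lemma sum_ord_ltn n b : b <= n -> \sum_(j < n) (j < b) = b.
Proof. by move=> bn; rewrite -[RHS]subn0 -(@sum_ord_between n 0 b). Qed.

Lemma sum_perm_between n a b (t : 'S_n) : a <= b -> b <= n ->
  \sum_(j < n) (a <= t j < b) = b - a.
Proof.
move=> ab bn; rewrite -(@sum_ord_between n a b) //.
by rewrite [RHS](reindex_inj (@perm_inj _ t)).
Qed.

Lemma sum_perm_ltn n b (t : 'S_n) : b <= n -> \sum_(j < n) (t j < b) = b.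
Proof. by move=> bn; rewrite -[RHS]subn0 -(@sum_perm_between n 0 b t). Qed.

(* Separate bounds [a] and [b] let the recursion treat the value and the
   position of the next index one after the other. *)
Definition opening n a b (t : 'S_n) := [forall i : 'I_n, (i < a) ==> (b <= t i)].

Lemma openingP n a b (t : 'S_n) :
  reflect (forall i : 'I_n, i < a -> b <= t i) (opening a b t).
Proof. by apply: (iffP forallP) => ht i; apply/implyP; exact: ht. Qed.

(** The fixed point lies under the [h] arcs leaving positions below [h], whence [h] nestings and no
    crossing. *)
Lemma lift_perm_fixed_stats n (h : 'I_n.+1) (t : 'S_n) : opening h h t ->
  let t' := lift_perm h h t in
  [/\ wex t' = (wex t).+1, fixn t' = (fixn t).+1, cros t' = cros t,
      nest t' = nest t + h & invn t' = invn t + 2 * h].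
Proof.
move=> /openingP ht /=; have hn : h <= n by rewrite -ltnS.
split; rewrite ?(wexE, fixnE, crosE, nestE, invnE).
- rewrite stat1_lift leqnn; congr S; apply: eq_stat1 => i; rewrite /bump; lia.
- rewrite stat1_lift eqxx; congr S; apply: eq_stat1 => i; rewrite /bump; lia.
- rewrite stat2_lift; last by rewrite /cross; lia.
  rewrite big1 ?add0n; last first.
    by move=> j _; have := ht j; rewrite /cross /bump; lia.
  apply: eq_stat2 => i j; rewrite /cross /bump; lia.
- rewrite stat2_lift; last by rewrite /nesting; lia.
  rewrite addnC; congr addn.
    apply: eq_stat2 => i j; rewrite /nesting /bump; lia.
  rewrite -[RHS](@sum_ord_ltn n) //; apply: eq_bigr => j _.
  by have := ht j; rewrite /nesting /bump; lia.
- rewrite stat2_lift; last by rewrite /inversion; lia.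
  rewrite addnC; congr addn.
    apply: eq_stat2 => i j; rewrite /inversion /bump; lia.
  (* By [opening h h], the inversions with the new point come from all positions below [h] and from
     all values below [h]. *)
  have -> : 2 * h = \sum_(j < n) (j < h) + \sum_(j < n) (t j < h).
    by rewrite sum_ord_ltn // sum_perm_ltn // mul2n addnn.
  rewrite -big_split; apply: eq_bigr => j _.
  by have := ht j; rewrite /inversion /bump /=; lia.
Qed.

(** Position [h] becomes open. The new arc crosses those of the [h - u] open positions after [u],
    including [h], and nests under those of the [u] positions before it. *)
Lemma lift_perm_close_pos_stats n (u h : 'I_n.+1) (t : 'S_n) :
  u < h -> opening h h t ->
  let t' := lift_perm u h t in
  [/\ wex t' = (wex t).+1, fixn t' = fixn t, cros t' = cros t + (h - u),
      nest t' = nest t + u & invn t' = invn t + (u + h)].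
Proof.
move=> uh /openingP ht /=; have hn : h <= n by rewrite -ltnS.
have un : u <= n by rewrite -ltnS.
split; rewrite ?(wexE, fixnE, crosE, nestE, invnE).
- rewrite stat1_lift ltnW //; congr S; apply: eq_stat1 => i.
  by have := ht i; rewrite /bump; lia.
- rewrite stat1_lift eqn_leq leqNgt uh /=; apply: eq_stat1 => i.
  by have := ht i; rewrite /bump; lia.
- rewrite stat2_lift; last by rewrite /cross; lia.
  rewrite addnC; congr addn.
    apply: eq_stat2 => i j; have := ht i; have := ht j.
    rewrite /cross /bump; lia.
  rewrite -[RHS](@sum_ord_between n) //; last exact: ltnW.
  by apply: eq_bigr => j _; have := ht j; rewrite /cross /bump; lia.
- rewrite stat2_lift; last by rewrite /nesting; lia.
  rewrite addnC; congr addn.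
    apply: eq_stat2 => i j; have := ht i; have := ht j.
    rewrite /nesting /bump; lia.
  rewrite -[RHS](@sum_ord_ltn n) //; apply: eq_bigr => j _.
  by have := ht j; rewrite /nesting /bump; lia.
- rewrite stat2_lift; last by rewrite /inversion; lia.
  rewrite addnC; congr addn.
    apply: eq_stat2 => i j; rewrite /inversion /bump; lia.
  have -> : u + h = \sum_(j < n) (j < u) + \sum_(j < n) (t j < h).
    by rewrite sum_ord_ltn // sum_perm_ltn.
  rewrite -big_split; apply: eq_bigr => j _.
  by have := ht j; rewrite /inversion /bump /=; lia.
Qed.

(** Value [h] becomes open, but crossings of arcs going down are strict, so the arc into [h] does
    not count: hence [h.-1 - v] against [h - u] above. *)
Lemma lift_perm_close_val_stats n (h v : 'I_n.+1) (t : 'S_n) :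
  v < h -> opening h h t ->
  let t' := lift_perm h v t in
  [/\ wex t' = wex t, fixn t' = fixn t, cros t' = cros t + (h.-1 - v),
      nest t' = nest t + v & invn t' = invn t + (h + v)].
Proof.
move=> vh /openingP ht /=; have hn : h <= n by rewrite -ltnS.
have vn : v <= n by rewrite -ltnS.
split; rewrite ?(wexE, fixnE, crosE, nestE, invnE).
- rewrite stat1_lift leqNgt vh; apply: eq_stat1 => i.
  by have := ht i; rewrite /bump; lia.
- rewrite stat1_lift ltn_eqF //; apply: eq_stat1 => i.
  by have := ht i; rewrite /bump; lia.
- rewrite stat2_lift; last by rewrite /cross; lia.
  rewrite addnC; congr addn.
    apply: eq_stat2 => i j; have := ht i; have := ht j.
    rewrite /cross /bump; lia.
  rewrite -[RHS](@sum_perm_between n _ _ t) //; try lia.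
  by apply: eq_bigr => j _; have := ht j; rewrite /cross /bump; lia.
- rewrite stat2_lift; last by rewrite /nesting; lia.
  rewrite addnC; congr addn.
    apply: eq_stat2 => i j; have := ht i; have := ht j.
    rewrite /nesting /bump; lia.
  rewrite -[RHS](@sum_perm_ltn n _ t) //; apply: eq_bigr => j _.
  by have := ht j; rewrite /nesting /bump; lia.
- rewrite stat2_lift; last by rewrite /inversion; lia.
  rewrite addnC; congr addn.
    apply: eq_stat2 => i j; rewrite /inversion /bump; lia.
  have -> : h + v = \sum_(j < n) (j < h) + \sum_(j < n) (t j < v).
    by rewrite sum_ord_ltn // sum_perm_ltn.
  rewrite -big_split; apply: eq_bigr => j _.
  by have := ht j; rewrite /inversion /bump /=; lia.
Qed.

Lemma lift_perm_close_both_stats n (u h : 'I_n.+2) (k v : 'I_n.+1) (t : 'S_n) :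
  h = k.+1 :> nat -> u < h -> v < h -> opening k k t ->
  let t' := lift_perm u h (lift_perm k v t) in
  [/\ wex t' = (wex t).+1, fixn t' = fixn t,
      cros t' = cros t + (k - u + (k - v)),
      nest t' = nest t + (u + v) & invn t' = invn t + (u + v + (2 * k).+1)].
Proof.
move=> hk uh vh /openingP ht /=; have kn : k <= n by rewrite -ltnS.
have vn : v <= n by rewrite -ltnS.
have hn : h <= n.+1 by rewrite -ltnS.
set t1 := lift_perm k v t.
have t1k : t1 k = v by apply: lift_perm_id.
(* [t1] is not [opening h h], since position [k] goes to [v]; this describes its first [h] positions
   instead. *)
have ht1 (j : 'I_n.+1) : (j < k -> k < t1 j) /\ (j = k :> nat -> t1 j = v :> nat).
  case: (unliftP k j) => [j'|] ->; last by rewrite t1k; lia.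
  by rewrite lift_perm_lift /= /bump; have := ht j'; lia.
split; rewrite ?(wexE, fixnE, crosE, nestE, invnE).
- rewrite !stat1_lift; have -> : u <= h by lia.
  rewrite add1n; congr S; rewrite -[RHS]add0n; congr addn.
    by rewrite /bump; lia.
  by apply: eq_stat1 => i; have := ht i; rewrite /bump; lia.
- rewrite !stat1_lift; have -> : (h == u :> nat) = false by lia.
  rewrite add0n -[RHS]add0n; congr addn; first by rewrite /bump; lia.
  by apply: eq_stat1 => i; have := ht i; rewrite /bump; lia.
- rewrite stat2_lift; last by rewrite /cross; lia.
  rewrite stat2_lift; last by rewrite /cross /bump; lia.
  rewrite addnA addnC; congr addn.
    apply: eq_stat2 => i j; have := ht i; have := ht j.
    rewrite /cross /bump; lia.
  congr addn.
    rewrite -[RHS](@sum_ord_between n.+1) //; try lia.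
    by apply: eq_bigr => j _; move: (t1 j) (ht1 j) => a; rewrite /cross /bump; lia.
  rewrite -[RHS](@sum_perm_between n _ _ t) //; try lia.
  by apply: eq_bigr => j _; have := ht j; rewrite /cross /bump; lia.
- rewrite stat2_lift; last by rewrite /nesting; lia.
  rewrite stat2_lift; last by rewrite /nesting /bump; lia.
  rewrite addnA addnC; congr addn.
    apply: eq_stat2 => i j; have := ht i; have := ht j.
    rewrite /nesting /bump; lia.
  congr addn.
    rewrite -[RHS](@sum_ord_ltn n.+1) //; try lia.
    by apply: eq_bigr => j _; move: (t1 j) (ht1 j) => a; rewrite /nesting /bump; lia.
  rewrite -[RHS](@sum_perm_ltn n _ t) //; try lia.
  by apply: eq_bigr => j _; have := ht j; rewrite /nesting /bump; lia.
- rewrite stat2_lift; last by rewrite /inversion; lia.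
  rewrite stat2_lift; last by rewrite /inversion /bump; lia.
  rewrite addnA addnC; congr addn.
    by apply: eq_stat2 => i j; rewrite /inversion /bump; lia.
  have -> : u + v + (2 * k).+1 =
    \sum_(j < n.+1) ((j < u) + (t1 j < h)) + \sum_(j < n) ((j < k) + (t j < v)).
    by rewrite !big_split /= !sum_ord_ltn ?sum_perm_ltn //; lia.
  congr addn; apply: eq_bigr => j _.
    by move: (t1 j) (ht1 j) => a; rewrite /inversion /bump /=; lia.
  by have := ht j; rewrite /inversion /bump /=; lia.
Qed.

End PointRemoval.

(** * Open indices and sums over permutations under removal of a point *)

Section OpeningSums.
Local Open Scope nat_scope.

Lemma opening_lift n a b (u v : 'I_n.+1) (t : 'S_n) :
  opening a b (lift_perm u v t) =
    ((u < a) ==> (b <= v)) &&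
    [forall i : 'I_n, (bump u i < a) ==> (b <= bump v (t i))].
Proof.
apply/forallP/andP => [ht | [hu /forallP ht] i].
  split; first by have := ht u; rewrite lift_perm_id.
  by apply/forallP => i; have := ht (lift u i); rewrite lift_perm_lift.
by case: (unliftP u i) => [j|] ->; rewrite ?lift_perm_id ?lift_perm_lift /= ?hu ?ht.
Qed.

Lemma opening_lift_close_pos n (u h : 'I_n.+1) (t : 'S_n) : u <= h ->
  opening h.+1 h (lift_perm u h t) = opening h h t.
Proof.
move=> uh; rewrite opening_lift leqnn implybT /=.
by apply: eq_forallb => i; rewrite /bump; lia.
Qed.

Lemma opening_lift_close_val n (h v : 'I_n.+1) (t : 'S_n) : v < h ->
  opening h h.+1 (lift_perm h v t) = opening h h t.
Proof.
move=> vh; rewrite opening_lift ltnn /=.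
by apply: eq_forallb => i; rewrite /bump; lia.
Qed.

Lemma opening_lift_close_both n (u h : 'I_n.+2) (k v : 'I_n.+1) (t : 'S_n) :
  h = k.+1 :> nat -> u < h -> v < h ->
  opening h h (lift_perm u h (lift_perm k v t)) = opening k k t.
Proof.
move=> hk uh vh; rewrite opening_lift leqnn implybT /=.
transitivity (opening k h (lift_perm k v t)).
  by apply: eq_forallb => i; rewrite /bump; lia.
rewrite opening_lift ltnn /=.
by apply: eq_forallb => i; rewrite /bump; lia.
Qed.

Lemma lift_perm_surj n (i j : 'I_n.+1) (s : 'S_n.+1) :
  s i = j -> exists t, s = lift_perm i j t.
Proof.
move=> sij.
have lft (k : 'I_n) : exists m, s (lift i k) == lift j m.
  case: (unliftP j (s (lift i k))) => [m ->|]; first by exists m.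
  by rewrite -sij => /perm_inj /eqP; rewrite eq_sym (negbTE (neq_lift _ _)).
pose f k := xchoose (lft k).
have fE k : s (lift i k) = lift j (f k) by apply/eqP/(xchooseP (lft k)).
have f_inj : injective f.
  by move=> k l fkl; apply/(@lift_inj _ i)/(@perm_inj _ s); rewrite !fE fkl.
exists (perm f_inj); apply/permP => k.
case: (unliftP i k) => [l|] ->; last by rewrite lift_perm_id.
by rewrite lift_perm_lift permE fE.
Qed.

Lemma lift_perm_inj n (i j : 'I_n.+1) : injective (@lift_perm n i j).
Proof.
move=> s t st; apply/permP => k; apply: (@lift_inj _ j).
by rewrite -2!(@lift_perm_lift _ i) st.
Qed.

End OpeningSums.

Section Sums.
Variables (V : nmodType).

Lemma sum_lift_perm n (i j : 'I_n.+1) (P : pred 'S_n.+1) (F : 'S_n.+1 -> V) :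
  \sum_(t | P t && (t i == j)) F t =
  \sum_(t : 'S_n | P (lift_perm i j t)) F (lift_perm i j t).
Proof.
rewrite -[RHS]big_imset; last by move=> s t _ _; apply: lift_perm_inj.
apply: eq_bigl => t; apply/andP/imsetP => [[Pt /eqP tij]|[s Ps ->]].
  have [s ts] := lift_perm_surj tij.
  by exists s; rewrite ?unfold_in -?ts.
by split; rewrite ?lift_perm_id //; exact: Ps.
Qed.

(** Cases on the preimage of [h]: outside the first [a] positions it raises the value bound to
    [h.+1], otherwise it is a unique [u < a]. *)
Lemma sum_opening_preimage n a (h : 'I_n) (P : pred 'S_n) (F : 'S_n -> V) :
  \sum_(t | opening a h t && P t) F t =
  \sum_(t | opening a h.+1 t && P t) F t +
  \sum_(u < n | (u < a)%N) \sum_(t | opening a h t && P t && (t u == h)) F t.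
Proof.
rewrite addrC (bigID (fun t : 'S_n => (t^-1%g h < a)%N)) /=; congr (_ + _).
  rewrite (partition_big (fun t : 'S_n => t^-1%g h) (fun u => u < a)%N) /=.
    apply: eq_bigr => u ua; apply: eq_bigl => t.
    rewrite (can2_eq (permKV t) (permK t)) eq_sym.
    by case: eqP => [<-|]; rewrite ?andbF // permK ua !andbT.
  by move=> t /andP[].
apply: eq_bigl => t; rewrite andbAC; congr (_ && P t).
apply/andP/idP => [[/openingP ht ha]|/openingP ht].
  apply/openingP => i ia; rewrite ltn_neqAle ht // andbT.
  by apply: contraNneq ha => hti; rewrite (_ : h = t i) ?permK //; apply: val_inj.
split; first by apply/openingP => i /ht /ltnW.
by apply/negP => /ht; rewrite permKV ltnn.
Qed.

End Sums.

(** * The recursion on weighted sums *)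

Section Weights.
Variables (R : comNzRingType) (x y q p s : R).

Definition weight n (t : 'S_n) : R :=
  x ^+ wex t * y ^+ fixn t * q ^+ cros t * p ^+ nest t * s ^+ invn t.

Definition opening_sum n h : R := \sum_(t : 'S_n | opening h h t) weight t.

Lemma qint_rev h :
  \sum_(u < h) q ^+ (h.-1 - u) * (p * s) ^+ u = qint q (p * s) h.
Proof.
rewrite /qint (reindex_inj rev_ord_inj) /=; apply: eq_bigr => u _.
by have uh := ltn_ord u; congr (q ^+ _ * (p * s) ^+ _); lia.
Qed.

Lemma sum_fixed n (h : 'I_n.+1) :
  \sum_(t | opening h.+1 h t && (t h == h)) weight t =
  x * y * p ^+ h * s ^+ (2 * h) * opening_sum n h.
Proof.
rewrite sum_lift_perm big_distrr /=; apply: eq_big => t.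
  exact: opening_lift_close_pos.
rewrite opening_lift_close_pos // => /lift_perm_fixed_stats[].
by rewrite /weight => -> -> -> -> ->; rewrite !(exprS, exprD); ring.
Qed.

Lemma sum_close_pos n (u h : 'I_n.+1) : (u < h)%N ->
  \sum_(t | opening h.+1 h t && (t u == h)) weight t =
  x * q ^+ (h - u) * (p * s) ^+ u * s ^+ h * opening_sum n h.
Proof.
move=> uh; have uh' := ltnW uh.
rewrite sum_lift_perm big_distrr /=; apply: eq_big => t.
  exact: opening_lift_close_pos.
rewrite opening_lift_close_pos // => /(lift_perm_close_pos_stats uh)[].
rewrite /weight => -> -> -> -> ->.
by rewrite exprS !(exprD _ _ u) (exprD _ _ (h - u)) !exprD exprMn; ring.
Qed.

Lemma sum_close_val n (h v : 'I_n.+1) : (v < h)%N ->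
  \sum_(t | opening h h.+1 t && (t h == v)) weight t =
  q ^+ (h.-1 - v) * (p * s) ^+ v * s ^+ h * opening_sum n h.
Proof.
move=> vh; rewrite sum_lift_perm big_distrr /=; apply: eq_big => t.
  exact: opening_lift_close_val.
rewrite opening_lift_close_val // => /(lift_perm_close_val_stats vh)[].
by rewrite /weight => -> -> -> -> ->; rewrite !exprD exprMn; ring.
Qed.

Lemma sum_close_both n (u h v : 'I_n.+1) : (u < h)%N -> (v < h)%N ->
  \sum_(t | opening h h t && (t h == v) && (t u == h)) weight t =
  x * s ^+ (2 * h).-1 * (q ^+ (h.-1 - u) * (p * s) ^+ u) *
    (q ^+ (h.-1 - v) * (p * s) ^+ v) * opening_sum n.-1 h.-1.
Proof.
case: n u h v => [|n] u h v uh vh; first by have := ltn_ord h; lia.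
have [k hk] : {k : 'I_n.+1 | h = k.+1 :> nat}.
  have kn : (h.-1 < n.+1)%N by have := ltn_ord h; lia.
  by exists (Ordinal kn); rewrite /=; lia.
have [w vw] : {w : 'I_n.+1 | v = w :> nat}.
  have vn : (v < n.+1)%N by have := ltn_ord h; lia.
  by exists (Ordinal vn).
(* Once position [u] and value [h] are removed, position [h] is relabelled [k], while [v < h] keeps
   its label as [w]. *)
have luk : lift u k = h by apply: val_inj; rewrite /= /bump; lia.
have lhw : lift h w = v by apply: val_inj; rewrite /= /bump; lia.
have wh : (w < h)%N by lia.
rewrite sum_lift_perm.
rewrite (eq_bigl (fun t : 'S_n.+1 => opening h h (lift_perm u h t) && (t k == w))).
  2: move=> t; rewrite -(inj_eq (@lift_inj _ h)) -(lift_perm_lift u h t) luk.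
  2: by rewrite lhw.
rewrite sum_lift_perm big_distrr /=; apply: eq_big => t.
  by rewrite opening_lift_close_both // hk.
rewrite opening_lift_close_both //.
move=> /(lift_perm_close_both_stats hk uh wh)[].
rewrite /weight => -> -> -> -> ->; rewrite vw hk.
have -> : (2 * k.+1).-1 = (2 * k).+1 by lia.
rewrite succnK !exprD !exprS !exprD !exprMn; ring.
Qed.

Lemma opening_sumS n (h : 'I_n.+1) :
  opening_sum n.+1 h = opening_sum n.+1 h.+1 +
    jb x y q p s h * opening_sum n h +
    x * s ^+ (2 * h).-1 * jc q p s h ^+ 2 * opening_sum n.-1 h.-1.
Proof.
have qsum : \sum_(u < n.+1 | (u < h)%N) q ^+ (h.-1 - u) * (p * s) ^+ u =
    jc q p s h.
  rewrite -(big_ord_widen _ (fun u => q ^+ (h.-1 - u) * (p * s) ^+ u)).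
    exact: qint_rev.
  exact: ltnW.
(* If the image of [h] is at least [h], position [h] counts as open and the bound on positions rises
   to [h.+1]. *)
rewrite {1}/opening_sum (bigID (fun t : 'S_n.+1 => (h <= t h)%N)) /=.
rewrite (eq_bigl (fun t => opening h.+1 h t && true)); last first.
  move=> t; rewrite andbT; apply/andP/openingP => [[/openingP ht hh] i|ht].
    by rewrite ltnS leq_eqVlt => /orP[/eqP/val_inj -> //|]; apply: ht.
  by split; [apply/openingP => i ih; apply/ht/ltnW | apply: ht].
rewrite sum_opening_preimage.
have -> : \sum_(t : 'S_n.+1 | opening h.+1 h.+1 t && true) weight t =
    opening_sum n.+1 h.+1 by apply: eq_bigl => t; rewrite andbT.
rewrite (eq_bigr (fun u : 'I_n.+1 =>
  \sum_(t | opening h.+1 h t && (t u == h)) weight t)); last first.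
  by move=> u _; apply: eq_bigl => t; rewrite andbT.
rewrite (bigD1 h) //= sum_fixed.
rewrite (eq_big (fun u : 'I_n.+1 => (u < h)%N)
  (fun u : 'I_n.+1 => x * q * s ^+ h * opening_sum n h *
    (q ^+ (h.-1 - u) * (p * s) ^+ u))); first last.
- move=> u; rewrite ltnS andbC => uh.
  have {}uh : (u < h)%N by rewrite ltn_neqAle.
  rewrite sum_close_pos //.
  (* The additional [q], from the crossing with the arc of position [h], is the one in the
     coefficient [1 + x * q] of [jb]. *)
  have -> : (h - u = (h.-1 - u).+1)%N by lia.
  by rewrite exprS; ring.
- by move=> u; rewrite ltnS andbC -ltn_neqAle.
rewrite -big_distrr qsum /=.
(* Remaining case: [h] goes to some [v < h]. The preimage of [h] is then either beyond [h] or some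
   [u < h]. *)
rewrite (partition_big (fun t : 'S_n.+1 => t h) (fun v => v < h)%N) /=; last first.
  by move=> t /andP[_]; rewrite ltnNge.
rewrite (eq_bigr (fun v : 'I_n.+1 => (s ^+ h * opening_sum n h +
    x * s ^+ (2 * h).-1 * jc q p s h * opening_sum n.-1 h.-1) *
   (q ^+ (h.-1 - v) * (p * s) ^+ v))); last first.
  move=> v vh.
  under eq_bigl => t.
    rewrite -andbA (_ : _ && (t h == v) = (t h == v)); last first.
      by case: eqP => [->|]; rewrite ?andbF // -ltnNge vh.
    over.
  rewrite sum_opening_preimage sum_close_val //.
  rewrite (eq_bigr (fun u : 'I_n.+1 => x * s ^+ (2 * h).-1 *
    (q ^+ (h.-1 - v) * (p * s) ^+ v) * opening_sum n.-1 h.-1 *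
     (q ^+ (h.-1 - u) * (p * s) ^+ u))); last first.
    by move=> u uh; rewrite sum_close_both //; ring.
  by rewrite -big_distrr qsum /=; ring.
rewrite -big_distrr qsum /= /jb /jc; ring.
Qed.

(* At [h = 0] the junk value [h.-1 = 0] is harmless because [jc 0 = 0]. *)
Fixpoint motzkin m h : R :=
  if m is m'.+1 then
    x * s ^+ (2 * h + 1) * motzkin m' h.+1 + jb x y q p s h * motzkin m' h +
    jc q p s h ^+ 2 * motzkin m' h.-1
  else (h == 0)%:R.

Lemma jc0 : jc q p s 0 = 0.
Proof. by rewrite /jc /qint big_ord0. Qed.

(** Since [(h+1)^2 - h^2 = 2h+1], the prefactor creates the up-step weight [x * s ^+ (2 * h + 1)]
    and absorbs the [x * s ^+ (2 * h).-1] of a double match. *)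
Lemma opening_sum_motzkin m h :
  opening_sum (h + m) h = x ^+ h * s ^+ (h * h) * motzkin m h.
Proof.
elim: m h => [|m IH] h.
  rewrite addn0 /=; case: h => [|h].
    rewrite /opening_sum (big_pred1 1%g) => [|t].
      rewrite /weight wexE fixnE crosE nestE invnE /stat1 /stat2 !big_ord0.
      by rewrite !expr0 !mulr1.
    have -> : t = 1%g by apply/permP => -[].
    by rewrite /= eqxx; apply/openingP.
  (* A permutation of [h.+1] points has no value as large as [h.+1]. *)
  rewrite mulr0 /opening_sum big_pred0 // => t; apply/negP => /openingP ht.
  by have := ltn_ord (t ord0); rewrite ltnNge ht.
have hn : (h < (h + m).+1)%N by lia.
rewrite addnS (opening_sumS (Ordinal hn)) /= -addSn !IH.
case: h hn => [|h] hn; first by rewrite jc0 mul0n muln0 add0n expr1 muln1; ring.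
have -> : ((2 * h.+1).-1 = 2 * h + 1)%N by lia.
rewrite addSn !succnK IH.
have -> : (2 * h.+1 + 1 = 2 * h + 3)%N by lia.
have -> : (h.+2 * h.+2 = h * h + (2 * h + 1) + (2 * h + 3))%N by lia.
have -> : (h.+1 * h.+1 = h * h + (2 * h + 1))%N by lia.
by rewrite !exprS !exprD; ring.
Qed.

Lemma An_motzkin n : An n x y q p s = motzkin n 0.
Proof.
(* Writes 1 as [x ^+ 0 * s ^+ (0 * 0)] to match the case [h = 0], where the opening condition is
   vacuous. *)
rewrite -[RHS]mul1r -[X in X * _]mul1r -{1}(expr0 x) -(expr0 s).
rewrite -[in s ^+ _](muln0 0) -opening_sum_motzkin.
by rewrite /opening_sum; apply/esym/eq_bigl => t; apply/openingP.
Qed.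

End Weights.

(** * Convergents of the J-fraction *)

Section PowerSeries.
Variable R : comNzRingType.
Implicit Types f g h : fps R.

Definition conv f g : fps R := fun m => \sum_(i < m.+1) f i * g (m - i)%N.

Definition mulX f : fps R := fun m => if m is m'.+1 then f m' else 0.

Lemma eq_conv f f' g g' m : (forall i, (i <= m)%N -> f i = f' i) ->
  (forall i, (i <= m)%N -> g i = g' i) -> conv f g m = conv f' g' m.
Proof.
by move=> ff gg; apply: eq_bigr => i _; rewrite ff ?gg ?leq_subr // -ltnS.
Qed.

Lemma convE f g N m : (m < N)%N ->
  conv f g m = (\poly_(i < N) f i * \poly_(i < N) g i)`_m.
Proof.
move=> mN; rewrite coefM; apply: eq_bigr => i _.
by rewrite !coef_poly !ifT //; have := ltn_ord i; lia.
Qed.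

(** Coefficient [m] depends only on coefficients up to [m], so associativity is inherited from
    truncations to polynomials. *)
Lemma convA f g h m : conv f (conv g h) m = conv (conv f g) h m.
Proof.
pose P f := \poly_(i < m.+1) f i.
transitivity ((P f * (P g * P h))`_m); last rewrite mulrA.
  rewrite coefM; apply: eq_bigr => i _.
  by rewrite (@convE _ _ m.+1) ?coef_poly ?ltn_ord // ltnS leq_subr.
rewrite coefM; apply: eq_bigr => i _.
by rewrite (@convE _ _ m.+1) // !coef_poly ltnS leq_subr.
Qed.

Lemma conv_mulXl f g m : conv (mulX f) g m = mulX (conv f g) m.
Proof.
by case: m => [|m]; rewrite /conv big_ord_recl mul0r add0r ?big_ord0.
Qed.

Lemma conv_mulXr f g m : conv f (mulX g) m = mulX (conv f g) m.
Proof.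
case: m => [|m]; rewrite {1}/conv big_ord_recr subnn [mulX g 0]/= mulr0 /= addr0.
  by rewrite big_ord0.
by apply: eq_bigr => i _; rewrite subSn // -ltnS ltn_ord.
Qed.

Lemma convDl f f' g m :
  conv (fun i => f i + f' i) g m = conv f g m + conv f' g m.
Proof. by rewrite -big_split; apply: eq_bigr => i _; rewrite mulrDl. Qed.

Lemma convZl a f g m : conv (fun i => a * f i) g m = a * conv f g m.
Proof. by rewrite /conv big_distrr /=; apply: eq_bigr => i _; rewrite mulrA. Qed.

Lemma convZr a f g m : conv f (fun i => a * g i) m = a * conv f g m.
Proof. by rewrite /conv big_distrr /=; apply: eq_bigr => i _; rewrite mulrCA. Qed.

Lemma size_fps_inv_seq f m : size (fps_inv_seq f m) = m.+1.
Proof. by elim: m => //= m IH; rewrite size_rcons IH. Qed.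

Lemma nth_fps_inv_seq f m i : (i <= m)%N ->
  nth 0 (fps_inv_seq f m) i = fps_inv f i.
Proof.
elim: m => [|m IH]; first by rewrite leqn0 => /eqP ->.
rewrite leq_eqVlt => /predU1P[-> //|im] /=.
by rewrite nth_rcons size_fps_inv_seq im IH.
Qed.

Lemma fps_invS f m :
  fps_inv f m.+1 = - \sum_(i < m.+1) f i.+1 * fps_inv f (m - i)%N.
Proof.
rewrite {1}/fps_inv /= nth_rcons size_fps_inv_seq ltnn eqxx; congr (- _).
by apply: eq_bigr => i _; rewrite nth_fps_inv_seq // leq_subr.
Qed.

End PowerSeries.

(** * Products of tails of the J-fraction as Motzkin path series *)

Section Convergents.
Variables (R : comNzRingType) (x y q p s : R).
Local Notation Z := (jconv x y q p s).
Local Notation b := (jb x y q p s).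
Local Notation c := (jc q p s).
Local Notation u h := (x * s ^+ (2 * h + 1)).

Lemma jconv0 k h : Z k h 0%N = 1.
Proof. by case: k. Qed.

(** Coefficients of [Z = 1 + b t Z + u c^2 t^2 Z' Z], where [Z'] is the next tail; the square
    appears because [ja h] is [u h * c h.+1]. *)
Lemma jconvS k h m : Z k.+1 h m.+1 =
  b h * Z k.+1 h m + u h * c h.+1 ^+ 2 * mulX (conv (Z k h.+1) (Z k.+1 h)) m.
Proof.
pose f : fps R := fun i => (i == 0)%:R - (if i == 1 then b h else 0)
  - ja x q p s h * c h.+1 * (if (2 <= i)%N then Z k h.+1 (i - 2)%N else 0).
have ZE : Z k.+1 h = fps_inv f by [].
have f1 : f 1%N = - b h by rewrite /f mulr0 subr0 sub0r.
have fSS i : f i.+2 = - (u h * c h.+1 ^+ 2 * Z k h.+1 i).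
  by rewrite /f !subr0 sub0r subn2 /ja expr2 !mulrA.
rewrite ZE fps_invS -ZE big_ord_recl f1 subn0 mulNr opprD opprK; congr (_ + _).
case: m => [|m]; first by rewrite big_ord0 mulr0 oppr0.
rewrite [mulX _ _]/= /conv mulr_sumr -sumrN; apply: eq_bigr => i _.
by rewrite lift0 fSS subSS mulNr opprK mulrA.
Qed.

(* Generating series of the Motzkin paths from height [h] to height 0: such a
   path stays at height [>= h] until its first step down to [h - 1]. *)
Fixpoint path_series K h : fps R :=
  if h is h'.+1 then
    fun m => c h ^+ 2 * mulX (conv (Z (K - h) h) (path_series K h')) m
  else Z K 0.

(** Expand the top factor of the product by [jconvS]. Its depth [K - h] is positive as [h < K], and
    drops by one per level, so the next tail is the factor at height [h.+1]. *)
Lemma path_seriesS K h m : (h < K)%N ->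
  path_series K h m.+1 =
    u h * path_series K h.+1 m + b h * path_series K h m +
    c h ^+ 2 * path_series K h.-1 m.
Proof.
case: K => [//|K]; rewrite ltnS; case: h => [|h] hK.
  have V0 i : path_series K.+1 0 i = Z K.+1 0 i by [].
  have V1 i : path_series K.+1 1 i =
      c 1 ^+ 2 * mulX (conv (Z K 1) (Z K.+1 0)) i.
    by rewrite [LHS]/= subSS subn0.
  rewrite V1 !V0 jconvS jc0 expr0n mul0r addr0 addrC.
  by rewrite -mulrA.
have Kh : (K.+1 - h.+1 = (K - h.+1).+1)%N by rewrite subSn.
pose V := path_series K.+1 h.
pose F := Z (K - h.+1) h.+2.
pose G := Z (K - h.+1).+1 h.+1.
have VS i : path_series K.+1 h.+1 i = c h.+1 ^+ 2 * mulX (conv G V) i.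
  by rewrite /= -/V Kh.
have VSS i : path_series K.+1 h.+2 i =
    c h.+2 ^+ 2 * (c h.+1 ^+ 2 * mulX (mulX (conv (conv F G) V)) i).
  rewrite [LHS]/= -/(path_series K.+1 h.+1) subSS -/F.
  congr (_ * _); case: i => [|i] /=; first by rewrite mulr0.
  rewrite (eq_conv (f' := F)
    (g' := fun i => c h.+1 ^+ 2 * mulX (conv G V) i)) //; last first.
    by move=> j _; apply: VS.
  rewrite convZr conv_mulXr; congr (_ * _); case: i => //= i; exact: convA.
rewrite !VS VSS /= -/V; case: m => [|m] /=.
  by rewrite /conv big_ord1 [G _]jconv0; ring.
(* The constant term 1 of [G] gives the step down, [b h.+1 * G] the level step, and [conv F G] the
   step up. *)
have -> : conv G V m.+1 = V m.+1 + conv (fun i => b h.+1 * G i +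
    u h.+1 * c h.+2 ^+ 2 * mulX (conv F G) i) V m.
  rewrite {1}/conv big_ord_recl [G _]jconv0 mul1r subn0; congr (_ + _).
  by apply: eq_bigr => i _; rewrite [G _]jconvS.
by rewrite convDl !convZl conv_mulXl; ring.
Qed.

(** Both sides obey the same recursion. A path of [m] steps climbs at most to [h + m], so the bound
    keeps every height within reach of [path_seriesS]. *)
Lemma path_series_motzkin K h m : (h + m <= K)%N ->
  path_series K h m = motzkin x y q p s m h.
Proof.
elim: m h => [|m IH] h hK.
  by case: h hK => [|h] _ /=; rewrite ?jconv0 ?mulr0.
rewrite path_seriesS; last by lia.
by rewrite [RHS]/= !IH //; lia.
Qed.

End Convergents.

(* Equality of formal power series in t, the infinite J-fraction being the
   t-adic limit of its convergents: every coefficient of the convergents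
   eventually equals the corresponding coefficient of the left-hand side. *)
Theorem theorem4p1 (R : comNzRingType) (x y q p s : R) :
  forall n : nat, exists K : nat, forall k : nat, (K <= k)%N ->
    jconv x y q p s k 0 n = (if n == 0%N then 1 else An n x y q p s).
Proof.
(* A path of [n] steps from height 0 never exceeds height [n], so depth [n] already fixes
   coefficient [n]. *)
move=> n; exists n => k nk.
rewrite -[LHS]/(path_series x y q p s k 0 n) path_series_motzkin // -An_motzkin.
by case: eqP => // ->; rewrite An_motzkin.
Qed.
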